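(* Let $F:\mathbb{R}^n\rightrightarrows\mathbb{R}^q$ be a set-valued map with $\operatorname{dom}F\neq\emptyset$. The optimizer design algorithm applied to $F$ is correct: if it terminates after finitely many steps, then it returns an optimizer $x$ of $F$.
   Context: A set-valued map $F:\mathbb{R}^n\rightrightarrows\mathbb{R}^q$ assigns to each $x\in\mathbb{R}^n$ a (possibly empty) subset $F(x)\subseteq\mathbb{R}^q$; $\operatorname{dom}F=\{x\in\mathbb{R}^n : F(x)\neq\emptyset\}$. A point $\bar x\in\mathbb{R}^n$ is an optimizer of $F$ if there is no $x\in\mathbb{R}^n$ with $F(x)\supsetneq F(\bar x)$. Value function: $v_F:2^{\mathbb{R}^q}\to 2^{\mathbb{R}^q}$, $v_F(Y)=\{z\in\mathbb{R}^q : \exists x\in\mathbb{R}^n,\ z\in F(x),\ Y\subseteq F(x)\}$. A set $Z\subseteq\mathbb{R}^q$ is a fixed point of $v_F$ if $Z=v_F(Z)$. A set $Y\subseteq\mathbb{R}^q$ generates a fixed point of $v_F$ if there is a fixed point $Z$ of $v_F$ with $v_F(Y)=v_F(Z)$. Optimizer design algorithm (input: $F$ with $\operatorname{dom}F\neq\emptyset$): start with $Y:=\emptyset$. While $Y$ does not generate a fixed point of $v_F$, perform a decision-making step: choose some (arbitrary) $y\in v_F(Y)$ and replace $Y$ by $Y\cup\{y\}$. After the loop, determine some $x\in\mathbb{R}^n$ with $v_F(Y)=F(x)$ and return $x$. *)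

(* Defs.v *)
From mathcomp Require Import all_boot all_algebra.
From mathcomp Require Import classical_sets reals.
From Stdlib Require Import Relation_Operators.

Set Implicit Arguments.
Unset Strict Implicit.
Unset Printing Implicit Defensive.

Local Open Scope classical_set_scope.

Definition set_valued_map (R : realType) (n q : nat) : Type :=
  'rV[R]_n -> set 'rV[R]_q.

Section OptimizerDesign.
Variables (R : realType) (n q : nat) (F : set_valued_map R n q).

Definition dom : set 'rV[R]_n := [set x | F x !=set0].

Definition optimizer (xbar : 'rV[R]_n) : Prop :=
  ~ exists x : 'rV[R]_n, F xbar `<` F x.

Definition value_function (Y : set 'rV[R]_q) : set 'rV[R]_q :=
  [set z | exists x : 'rV[R]_n, F x z /\ Y `<=` F x].

Definition fixed_point (Z : set 'rV[R]_q) : Prop := Z = value_function Z.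

Definition generates_fixed_point (Y : set 'rV[R]_q) : Prop :=
  exists Z : set 'rV[R]_q,
    fixed_point Z /\ value_function Y = value_function Z.

(* The algorithm is nondeterministic (arbitrary choice of y, and of x), so it
   is modelled as a transition system: [Loop Y] is the state at the loop test
   with current set Y, and [Return x] is the state after returning x. *)
Inductive state : Type :=
| Loop of set 'rV[R]_q
| Return of 'rV[R]_n.

Inductive step : state -> state -> Prop :=
| step_decide (Y : set 'rV[R]_q) (y : 'rV[R]_q) :
    ~ generates_fixed_point Y -> value_function Y y ->
    step (Loop Y) (Loop (Y `|` [set y]))
| step_return (Y : set 'rV[R]_q) (x : 'rV[R]_n) :
    generates_fixed_point Y -> value_function Y = F x ->
    step (Loop Y) (Return x).

(* Some run stops in [s] after finitely many steps. A state [Loop Y] in which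
   the required y or x does not exist would also count as a stopping state. *)
Definition terminates_in (s : state) : Prop :=
  clos_refl_trans_1n state step (Loop set0) s /\ ~ exists s', step s s'.

End OptimizerDesign.

Arguments Loop {R n q}.
Arguments Return {R n q}.

(* Main.v *)
Require Import Defs.
From mathcomp Require Import all_boot all_algebra.
From mathcomp Require Import boolp classical_sets reals.
From Stdlib Require Import Relation_Operators.

(** Call a set feasible if it lies in some nonempty value of [F]. Starting from
    the empty set, which is feasible because the domain is nonempty, each
    decision keeps the current set feasible: the value of [F] that witnesses
    the choice of [y] contains both [Y] and [y]. For feasible [Y] the set
    [value_function F Y] is nonempty, so a decision is always available when
    [Y] generates no fixed point.

    When [Y] does generate a fixed point [Z], then
    [value_function F Y = value_function F Z = Z]. A fixed point absorbs every
    value of [F] that contains it ([fixed_point_absorbs]). This has two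
    consequences: a nonempty fixed point is itself a value of [F]
    ([fixed_point_value]), so the algorithm finds some [x] to return, and no
    value of [F] is strictly larger than a fixed point
    ([fixed_point_optimizer]), so the returned [x] is an optimizer. Hence a run
    never gets stuck at the loop test and returns only optimizers. *)

Local Open Scope classical_set_scope.

Definition feasible {R : realType} {n q : nat} (F : set_valued_map R n q)
    (Y : set 'rV[R]_q) : Prop :=
  exists2 x, F x !=set0 & Y `<=` F x.

Lemma feasible_value_function (R : realType) (n q : nat)
    (F : set_valued_map R n q) (Y : set 'rV[R]_q) :
  feasible F Y -> value_function F Y !=set0.
Proof. by move=> [x [z Fxz] YFx]; exists z, x. Qed.

(** If [Z] is contained in [F x], then [x] witnesses that each point of [F x]
    belongs to [value_function F Z], which is [Z]. *)
Lemma fixed_point_absorbs (R : realType) (n q : nat)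
    (F : set_valued_map R n q) (Z : set 'rV[R]_q) (x : 'rV[R]_n) :
  fixed_point F Z -> Z `<=` F x -> F x `<=` Z.
Proof. by move=> fixZ ZFx z Fxz; rewrite fixZ; exists x. Qed.

(** A point of [Z], seen in [value_function F Z], provides a value of [F] that
    contains [Z]; absorption gives equality. *)
Lemma fixed_point_value (R : realType) (n q : nat)
    (F : set_valued_map R n q) (Z : set 'rV[R]_q) :
  fixed_point F Z -> Z !=set0 -> exists x, Z = F x.
Proof.
move=> fixZ [z]; rewrite {1}fixZ => -[x [_ ZFx]]; exists x.
by apply/seteqP; split=> //; apply: fixed_point_absorbs.
Qed.

Lemma fixed_point_optimizer (R : realType) (n q : nat)
    (F : set_valued_map R n q) (x : 'rV[R]_n) :
  fixed_point F (F x) -> optimizer F x.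
Proof.
move=> fixFx [x' [FxFx' nFx'Fx]].
by apply: nFx'Fx; apply: fixed_point_absorbs.
Qed.

Lemma generates_fixed_pointP (R : realType) (n q : nat)
    (F : set_valued_map R n q) (Y : set 'rV[R]_q) :
  generates_fixed_point F Y -> fixed_point F (value_function F Y).
Proof. by move=> [Z [fixZ ->]]; rewrite -fixZ. Qed.

Definition correct_state {R : realType} {n q : nat}
    (F : set_valued_map R n q) (s : state R n q) : Prop :=
  match s with
  | Loop Y => feasible F Y
  | Return x => optimizer F x
  end.

Lemma correct_state_step (R : realType) (n q : nat)
    (F : set_valued_map R n q) (s t : state R n q) :
  step F s t -> correct_state F s -> correct_state F t.
Proof.
case=> [Y y _ [x [Fxy YFx]] _|Y x genY vYx _] /=.
  by exists x; [exists y | move=> z [/YFx|->]].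
by apply: fixed_point_optimizer; rewrite -vYx; apply: generates_fixed_pointP.
Qed.

Lemma correct_state_run (R : realType) (n q : nat)
    (F : set_valued_map R n q) (s t : state R n q) :
  clos_refl_trans_1n (state R n q) (step F) s t ->
  correct_state F s -> correct_state F t.
Proof.
by elim=> // s1 s2 s3 s12 _ IH s1_correct; apply: IH; apply: correct_state_step s12 _.
Qed.

Lemma feasible_progress (R : realType) (n q : nat)
    (F : set_valued_map R n q) (Y : set 'rV[R]_q) :
  feasible F Y -> exists t, step F (Loop Y) t.
Proof.
move=> /feasible_value_function vY0.
have [genY|ngenY] := pselect (generates_fixed_point F Y).
  have [x vYx] := fixed_point_value _ _ _ _ _ (generates_fixed_pointP _ _ _ _ _ genY) vY0.
  by exists (Return x); apply: step_return.
by have [y vYy] := vY0; exists (Loop (Y `|` [set y])); apply: step_decide.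
Qed.

Theorem proposition3p6 (R : realType) (n q : nat) (F : set_valued_map R n q)
    (domF : dom F !=set0) (s : state R n q) (hs : terminates_in F s) :
  exists x : 'rV[R]_n, s = Return x /\ optimizer F x.
Proof.
have [run_s stuck_s] := hs.
have start_correct : correct_state F (Loop set0).
  by have [x Fx0] := domF; exists x.
have := correct_state_run _ _ _ _ _ _ run_s start_correct.
case: s {hs run_s} stuck_s => [Y|x] stuck /= s_correct; last by exists x.
by case: stuck; apply: feasible_progress.
Qed.
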